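(* Let $d\ge 1$ and let $A=(A^{(i,j)})_{1\le i,j\le d}$ be a $d\times d$ matrix of positive numbers. There exists a left-eigenvector $\bar\eta\in\mathbb{R}^d$ with positive coefficients, associated to the spectral radius $\rho(A)$ of $A$, i.e. $$\bar\eta^\top A=\rho(A)\,\bar\eta^\top .$$ Besides, $$|A|_{\bar\eta}=\rho(A)=\inf_{\eta\in\mathbb{R}^d_{>0}}|A|_\eta .$$
   Context: For $\eta\in\mathbb{R}^d_{>0}$ (all components positive) the weighted $1$-norm on $\mathbb{R}^d$ is $|X|_\eta=\sum_{i=1}^d|X^{(i)}|\,\eta^{(i)}$. For a $d\times d$ matrix $A$, $|A|_\eta=\sup_{|X|_\eta=1}|AX|_\eta$ denotes the associated operator norm; one has $|A|_\eta=\max_{1\le j\le d}\frac{1}{\eta^{(j)}}\sum_{i=1}^d|A^{(i,j)}|\,\eta^{(i)}$. *)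

(* Defs.v *)
From HB Require Import structures.
From mathcomp Require Import all_boot all_order all_algebra.
From mathcomp Require Import all_classical all_reals.
From mathcomp Require Import complex.

Set Implicit Arguments.
Unset Strict Implicit.
Unset Printing Implicit Defensive.

Import Order.TTheory GRing.Theory Num.Theory.

Local Open Scope classical_set_scope.
Local Open Scope ring_scope.

Definition pos_vec (R : realType) (d : nat) (eta : 'cV[R]_d) : Prop :=
  forall i : 'I_d, 0 < eta i 0.

(* [wnorm1 eta] is a norm only for [pos_vec eta]. *)
Definition wnorm1 (R : realType) (d : nat) (eta X : 'cV[R]_d) : R :=
  \sum_(i < d) `|X i 0| * eta i 0.

(* For [0 < d] and [pos_vec eta] the set below is nonempty and bounded,
   so [sup] does not take its default value. *)
Definition wopnorm1 (R : realType) (d : nat) (eta : 'cV[R]_d)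
    (A : 'M[R]_d) : R :=
  sup [set wnorm1 eta (A *m X) | X in [set X : 'cV[R]_d | wnorm1 eta X = 1]].

(* The supremum (a maximum when [0 < d]) of the moduli of the complex
   eigenvalues of the real matrix [A].  The library's [eigenvalue] refers to
   row eigenvectors; the spectrum is the same for column eigenvectors. *)
Definition spectral_radius (R : realType) (d : nat) (A : 'M[R]_d) : R :=
  sup [set ComplexField.Normc.normc z | z in
        [set z : complex R | eigenvalue (map_mx (real_complex R) A) z]].

(* Main.v *)
Require Import Defs.
From HB Require Import structures.
From mathcomp Require Import all_boot all_order all_algebra.
From mathcomp Require Import all_classical all_reals.
From mathcomp Require Import topology normedtype derive.
From mathcomp Require Import complex.

Set Implicit Arguments.
Unset Strict Implicit.
Unset Printing Implicit Defensive.

Import Order.TTheory GRing.Theory Num.Theory.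
Import numFieldNormedType.Exports.

Local Open Scope classical_set_scope.
Local Open Scope ring_scope.

(** The statement combines the Perron theorem for a positive matrix with an
    elementary estimate of the operator norm by column sums.

    The positive left eigenvector is obtained variationally.  On the simplex K
    of nonnegative row vectors with sum 1, the function sending x to
    min_j (x A A)_j / (x A)_j is continuous, because x A is positive on all of
    K, boundary included.  Let x be a maximizer, y = x A and r the maximum;
    then y is positive and y A >= r y coordinatewise.  If equality failed
    somewhere, multiplying the nonzero nonnegative vector y A - r y by A would
    give y A A > r y A in every coordinate, so that y, normalized to lie in K,
    would beat the maximum.  Hence y A = r y; this is
    [perron_left_eigenvector].

    Let eta = y^T.  For positive weights, if the weighted sum of the moduli of
    column j of a matrix is at most c times the weight of j for all j, then the
    matrix has weighted 1-operator norm at most c.  Applied to eta, where these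
    sums equal r eta_j, this bounds by r both the modulus of every complex
    eigenvalue, tested on a column eigenvector ([eigenvalue_norm_le]), and the
    operator norm ([wopnorm1_le]).  Conversely r is an eigenvalue of A, hence
    has a real column eigenvector, so r is at most the operator norm of A for
    every positive weight ([eigenvalue_le_wopnorm1]).  Thus r is the spectral
    radius, and the infimum of the operator norms is attained at eta. *)

(** * A positive left eigenvector *)

Lemma mulmx_pos_gt0 (R : realDomainType) (m n : nat) (A : 'M[R]_(m, n))
    (x : 'rV[R]_m) :
  (forall i j, 0 < A i j) -> (forall i, 0 <= x 0 i) -> x != 0 ->
  forall j, 0 < (x *m A) 0 j.
Proof.
move=> A_gt0 x_ge0 /rV0Pn[k xk_neq0] j; rewrite mxE (bigD1 k) //=.
apply: ltr_pwDl; first by rewrite mulr_gt0 // lt0r xk_neq0 x_ge0.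
by apply: sumr_ge0 => i _; rewrite mulr_ge0 // ltW.
Qed.

Lemma mulmxr_coord_continuous (R : realType) (m n : nat) (B : 'M[R]_(m, n))
    (j : 'I_n) :
  continuous (fun x : 'rV[R]_m => (x *m B) 0 j : R).
Proof.
under eq_fun do rewrite mxE.
apply: (continuous_big add_continuous) => i _ x.
by apply: continuousM; [exact: coord_continuous|exact: cst_continuous].
Qed.

Lemma bigmin_continuous (R : realType) (T : topologicalType) (I : Type)
    (s : seq I) (g : T -> R) (f : I -> T -> R) (x : T) :
  {for x, continuous g} -> (forall i, {for x, continuous (f i)}) ->
  {for x, continuous (fun y => \big[Num.min/g y]_(i <- s) f i y)}.
Proof.
move=> gx fx; rewrite /prop_for; elim: s => [|i s IHs].
  by under eq_fun do rewrite big_nil.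
by under eq_fun do rewrite big_cons; exact: (continuous_min (fx i) IHs).
Qed.

(** The Collatz-Wielandt quotient min_j (y A)_j / y_j of a positive row vector
    y: the largest c such that y A >= c y coordinatewise.  The default value of
    the iterated minimum is one of the terms, so it does not affect the
    result. *)
Definition collatz_wielandt (R : realType) (n : nat) (A : 'M[R]_n.+1)
    (y : 'rV[R]_n.+1) : R :=
  \big[Num.min/(y *m A) 0 0 / y 0 0]_j ((y *m A) 0 j / y 0 j).

Lemma collatz_wielandt_ge (R : realType) (n : nat) (A : 'M[R]_n.+1)
    (y : 'rV[R]_n.+1) :
  (forall j, 0 < y 0 j) ->
  forall j, collatz_wielandt A y * y 0 j <= (y *m A) 0 j.
Proof.
move=> y_gt0 j; rewrite -ler_pdivlMr // /collatz_wielandt.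
exact: bigmin_le_cond.
Qed.

Lemma collatz_wielandt_gt (R : realType) (n : nat) (A : 'M[R]_n.+1)
    (y : 'rV[R]_n.+1) (c : R) :
  (forall j, 0 < y 0 j) -> (forall j, c * y 0 j < (y *m A) 0 j) ->
  c < collatz_wielandt A y.
Proof.
move=> y_gt0 cy; rewrite /collatz_wielandt; apply: lt_bigmin => [|j _];
  by rewrite ltr_pdivlMr.
Qed.

Lemma simplex_compact (R : realType) (n : nat) :
  compact [set x : 'rV[R]_n | (forall i, 0 <= x 0 i) /\ \sum_i x 0 i = 1].
Proof.
have cube_compact : compact [set x : 'rV[R]_n | forall i, x ord0 i \in `[0, 1]].
  apply: (@rV_compact _ _ (fun=> `[0 : R, 1 : R]%classic)) => i.
  exact: segment_compact.
apply: (subclosed_compact _ cube_compact).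
- rewrite (_ : [set _ | _] =
    (\bigcap_i [set x : 'rV[R]_n | 0 <= x 0 i]) `&`
    [set x : 'rV[R]_n | \sum_i x 0 i = 1]).
    apply: closedI.
      apply: closed_bigI => i _.
      apply: (@preimage_closed _ _ (fun x : 'rV[R]_n => x 0 i)
        [set t | 0 <= t]).
        by move=> x _; exact: coord_continuous.
      exact: closed_ge.
    apply: (@preimage_closed _ _ (fun x : 'rV[R]_n => \sum_i x 0 i)
      [set t | t = 1]).
      move=> x _; apply: (continuous_big add_continuous) => i _ {}x.
      exact: coord_continuous.
    exact: closed_eq.
  apply/seteqP; split => x /= [x_ge0 x_sum1]; split => // i.
    by move=> _; exact: x_ge0.
  exact: x_ge0 i I.
- move=> x /= [x_ge0 x_sum1] i; rewrite in_itv /= x_ge0 -x_sum1 (bigD1 i) //=.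
  by rewrite lerDl sumr_ge0.
Qed.

Lemma perron_left_eigenvector (R : realType) (n : nat) (A : 'M[R]_n.+1) :
  (forall i j, 0 < A i j) ->
  exists (y : 'rV[R]_n.+1) (r : R),
    [/\ forall j, 0 < y 0 j, 0 < r & y *m A = r *: y].
Proof.
move=> A_gt0.
pose K := [set x : 'rV[R]_n.+1 | (forall i, 0 <= x 0 i) /\ \sum_i x 0 i = 1].
have KA_gt0 x : K x -> forall j, 0 < (x *m A) 0 j.
  case=> x_ge0 x_sum1; apply: mulmx_pos_gt0 => //.
  apply/eqP => x0; move: x_sum1; rewrite x0 big1 => [/eqP|i _].
    by rewrite eq_sym oner_eq0.
  by rewrite mxE.
have K_normalize (y : 'rV[R]_n.+1) :
    (forall j, 0 < y 0 j) -> exists2 s, 0 < s & K (s *: y).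
  move=> y_gt0; have s_gt0 : 0 < \sum_j y 0 j.
    by rewrite (bigD1 0) //= ltr_pwDl // sumr_ge0 // => j _; exact: ltW.
  exists (\sum_j y 0 j)^-1; first by rewrite invr_gt0.
  split=> [i|]; first by rewrite mxE mulr_ge0 ?invr_ge0 // ltW.
  under eq_bigr do rewrite mxE.
  by rewrite -mulr_sumr mulVf // gt_eqF.
have scale_coord s (u : 'rV[R]_n.+1) j : (s *: u) 0 j = s * u 0 j.
  by rewrite mxE.
have sub_coord (u v : 'rV[R]_n.+1) j : (u - v) 0 j = u 0 j - v 0 j.
  by rewrite !mxE.
have K_neq0 : K !=set0.
  have [|s _ Ks] := K_normalize (const_mx 1); last by exists (s *: const_mx 1).
  by move=> j; rewrite mxE.
have xAA_cont j : continuous (fun x : 'rV[R]_n.+1 => (x *m A *m A) 0 j : R).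
  by under eq_fun do rewrite -mulmxA; exact: mulmxr_coord_continuous.
(* The quotient is taken at x A, which is positive even when x has null
   coordinates. *)
have f_cont : {within K, continuous (fun x => collatz_wielandt A (x *m A))}.
  apply: continuous_in_subspaceT => x /set_mem Kx.
  have qx j : {for x, continuous
      (fun y : 'rV[R]_n.+1 => (y *m A *m A) 0 j / (y *m A) 0 j)}.
    apply: continuousM; first exact: xAA_cont.
    apply: continuousV; first by rewrite gt_eqF // KA_gt0.
    exact: mulmxr_coord_continuous.
  rewrite /collatz_wielandt; exact: (bigmin_continuous (qx 0) qx).
have [x /set_mem Kx x_max] :=
  EVT_max_rV K_neq0 (@simplex_compact R n.+1) f_cont.
set y := x *m A in x_max; set r := collatz_wielandt A y in x_max.
have y_gt0 : forall j, 0 < y 0 j := KA_gt0 x Kx.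
have yA_gt0 j : 0 < (y *m A) 0 j.
  apply: mulmx_pos_gt0 => // [i|]; first exact: ltW.
  by apply/eqP => y0; move: (y_gt0 0); rewrite y0 mxE ltxx.
have yA : y *m A = r *: y.
  apply/eqP; rewrite -subr_eq0; apply/negP => /negP w_neq0.
  (* If y A and r y differed, normalizing y would contradict the maximality
     of x. *)
  have [s s_gt0 Ksy] := K_normalize y y_gt0.
  have := x_max (s *: y) (mem_set Ksy); apply/negP; rewrite -ltNge.
  apply: collatz_wielandt_gt => j; first exact: KA_gt0.
  rewrite -!scalemxAl !scale_coord mulrCA ltr_pM2l // -subr_gt0.
  have -> : (y *m A *m A) 0 j - r * (y *m A) 0 j
            = ((y *m A - r *: y) *m A) 0 j.
    by rewrite mulmxBl -scalemxAl sub_coord scale_coord.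
  apply: mulmx_pos_gt0 => // i.
  by rewrite sub_coord scale_coord subr_ge0; exact: collatz_wielandt_ge.
exists y, r; split=> //.
by have := yA_gt0 0; rewrite yA scale_coord pmulr_lgt0.
Qed.

(** * Column sums, eigenvalues and the weighted operator norm *)

Lemma eigenvalue_tr (F : fieldType) (n : nat) (A : 'M[F]_n) (a : F) :
  eigenvalue A^T a = eigenvalue A a.
Proof.
rewrite /eigenvalue /eigenspace !kermx_eq0 !row_free_unit -unitmx_tr.
by rewrite linearB /= trmxK tr_scalar_mx.
Qed.

Lemma eigenvalue_colP (F : fieldType) (n : nat) (A : 'M[F]_n) (a : F) :
  reflect (exists2 X : 'cV_n, A *m X = a *: X & X != 0) (eigenvalue A a).
Proof.
rewrite -eigenvalue_tr; apply: (iffP eigenvalueP) => -[v vA v_neq0];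
  exists v^T; rewrite ?trmx_eq0 //.
  by rewrite -[A]trmxK -trmx_mul vA linearZ.
by rewrite -trmx_mul vA linearZ.
Qed.

(** This and the next two lemmas concern the weighted 1-norm over any
    numeric domain, so that they serve for the real norm [wnorm1] as well as
    for complex eigenvectors. *)
Lemma weighted_norm_mulmx_le (D : numDomainType) (n : nat) (eta : 'I_n -> D)
    (A : 'M[D]_n) (c : D) (X : 'cV[D]_n) :
  (forall i, 0 <= eta i) ->
  (forall j, \sum_i `|A i j| * eta i <= c * eta j) ->
  \sum_i `|(A *m X) i 0| * eta i <= c * \sum_j `|X j 0| * eta j.
Proof.
move=> eta_ge0 colA.
have termwise i : `|(A *m X) i 0| * eta i
    <= \sum_j `|X j 0| * (`|A i j| * eta i).
  rewrite mxE (le_trans (ler_wpM2r (eta_ge0 i) (ler_norm_sum _ _ _))) //.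
  rewrite mulr_suml ler_sum // => j _.
  by rewrite normrM mulrA [`|X j 0| * _]mulrC.
rewrite (le_trans (ler_sum _ (fun i _ => termwise i))) //.
rewrite exchange_big mulr_sumr.
apply: ler_sum => j _; rewrite -mulr_sumr mulrCA.
by apply: ler_wpM2l => //; exact: colA.
Qed.

Lemma weighted_norm_gt0 (D : numDomainType) (n : nat) (eta : 'I_n -> D)
    (X : 'cV[D]_n) :
  (forall i, 0 < eta i) -> X != 0 -> 0 < \sum_i `|X i 0| * eta i.
Proof.
move=> eta_gt0 /cV0Pn[k Xk_neq0]; rewrite (bigD1 k) //= ltr_pwDl //.
  by rewrite mulr_gt0 // normr_gt0.
by rewrite sumr_ge0 // => i _; rewrite mulr_ge0 // ltW.
Qed.

Lemma weighted_normZ (D : numDomainType) (n : nat) (eta : 'I_n -> D) (a : D)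
    (X : 'cV[D]_n) :
  \sum_i `|(a *: X) i 0| * eta i = `|a| * \sum_i `|X i 0| * eta i.
Proof.
by rewrite mulr_sumr; apply: eq_bigr => i _; rewrite mxE normrM mulrA.
Qed.

Lemma eigenvalue_norm_le (F : numFieldType) (n : nat) (eta : 'I_n -> F)
    (A : 'M[F]_n) (c a : F) :
  (forall i, 0 < eta i) ->
  (forall j, \sum_i `|A i j| * eta i <= c * eta j) ->
  eigenvalue A a -> `|a| <= c.
Proof.
move=> eta_gt0 colA /eigenvalue_colP[X AX X_neq0].
have := weighted_norm_mulmx_le X (fun i => ltW (eta_gt0 i)) colA.
by rewrite AX weighted_normZ ler_pM2r // weighted_norm_gt0.
Qed.

Lemma sup_eq_max (R : realType) (S : set R) (c : R) :
  S c -> ubound S c -> sup S = c.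
Proof.
move=> Sc Sle; apply/eqP; rewrite eq_le; apply/andP; split.
  by apply: ge_sup => //; exists c.
by apply: ub_le_sup => //; exists c.
Qed.

Lemma spectral_radius_eq (R : realType) (n : nat) (A : 'M[R]_n.+1)
    (y : 'rV[R]_n.+1) (r : R) :
  (forall i j, 0 <= A i j) -> (forall j, 0 < y 0 j) -> 0 <= r ->
  y *m A = r *: y -> spectral_radius A = r.
Proof.
move=> A_ge0 y_gt0 r_ge0 yA; apply: sup_eq_max => /=.
  exists (real_complex R r).
    rewrite eigenvalue_map; apply/eigenvalueP; exists y => //.
    by apply/eqP => y0; have := y_gt0 0; rewrite y0 mxE ltxx.
  by rewrite /= expr0n addr0 sqrtr_sqr ger0_norm.
move=> _ [z z_eig <-].
suff : `|z| <= real_complex R r by rewrite normc_def lecR; case: (z).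
apply: (@eigenvalue_norm_le _ _ (fun i => real_complex R (y 0 i))) z_eig.
  by move=> i; rewrite ltcR.
move=> j; rewrite -rmorphM /=; have /rowP/(_ j) := yA; rewrite !mxE => <-.
rewrite rmorph_sum; apply: ler_sum => i _.
by rewrite mxE ger0_norm ?lecR // mulrC rmorphM.
Qed.

(** The content is that the supremum defining [wopnorm1] is over a bounded set,
    and that X can be normalized. *)
Lemma wnorm1_mulmx_le_wopnorm1 (R : realType) (n : nat) (eta : 'cV[R]_n)
    (A : 'M[R]_n) (X : 'cV[R]_n) :
  pos_vec eta -> X != 0 ->
  wnorm1 eta (A *m X) <= wopnorm1 eta A * wnorm1 eta X.
Proof.
move=> eta_gt0 X_neq0.
have X_gt0 : 0 < wnorm1 eta X := weighted_norm_gt0 eta_gt0 X_neq0.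
rewrite -ler_pdivrMr // /wopnorm1; apply: ub_le_sup; last first.
  exists ((wnorm1 eta X)^-1 *: X) => /=.
    by rewrite /wnorm1 weighted_normZ gtr0_norm ?invr_gt0 // mulVf // gt_eqF.
  rewrite -scalemxAr /wnorm1 weighted_normZ gtr0_norm ?invr_gt0 //.
  by rewrite mulrC.
pose col j := \sum_i `|A i j| * eta i 0.
have col_ge0 j : 0 <= col j / eta j 0.
  apply: divr_ge0; last exact: ltW.
  by apply: sumr_ge0 => i _; rewrite mulr_ge0 // ltW.
(* The sum over j of the ratios (weighted sum of column j) / eta_j is a crude
   bound on the operator norm: it dominates each of the ratios. *)
exists (\sum_j col j / eta j 0) => _ [Y /= Y1 <-].
rewrite -[leRHS]mulr1 -[X in _ * X]Y1.
apply: weighted_norm_mulmx_le => [i|j]; first exact: ltW.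
by rewrite -ler_pdivrMr // [leRHS](bigD1 j) //= lerDl sumr_ge0.
Qed.

Lemma eigenvalue_le_wopnorm1 (R : realType) (n : nat) (eta : 'cV[R]_n)
    (A : 'M[R]_n) (a : R) :
  pos_vec eta -> eigenvalue A a -> `|a| <= wopnorm1 eta A.
Proof.
move=> eta_gt0 /eigenvalue_colP[X AX X_neq0].
have := wnorm1_mulmx_le_wopnorm1 A eta_gt0 X_neq0.
rewrite AX /wnorm1 weighted_normZ ler_pM2r //.
exact: weighted_norm_gt0.
Qed.

Lemma wopnorm1_le (R : realType) (n : nat) (eta : 'cV[R]_n.+1)
    (A : 'M[R]_n.+1) (c : R) :
  pos_vec eta ->
  (forall j, \sum_i `|A i j| * eta i 0 <= c * eta j 0) ->
  wopnorm1 eta A <= c.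
Proof.
move=> eta_gt0 colA; apply: ge_sup.
  pose X : 'cV[R]_n.+1 := const_mx 1.
  have X_gt0 : 0 < wnorm1 eta X.
    by apply: weighted_norm_gt0 => //; apply/cV0Pn; exists 0;
      rewrite mxE oner_eq0.
  exists (wnorm1 eta (A *m ((wnorm1 eta X)^-1 *: X))).
  exists ((wnorm1 eta X)^-1 *: X) => //=.
  by rewrite /wnorm1 weighted_normZ gtr0_norm ?invr_gt0 // mulVf // gt_eqF.
move=> _ [Y /= Y1 <-]; rewrite -[leRHS]mulr1 -[X in _ * X]Y1.
by apply: weighted_norm_mulmx_le => // i; exact: ltW.
Qed.

Theorem proposition4p2 (R : realType) (d : nat) (hd : (1 <= d)%N)
    (A : 'M[R]_d) (hA : forall i j : 'I_d, 0 < A i j) :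
  exists eta : 'cV[R]_d,
    [/\ pos_vec eta,
        eta^T *m A = spectral_radius A *: eta^T,
        wopnorm1 eta A = spectral_radius A &
        spectral_radius A =
          inf [set wopnorm1 eta' A | eta' in
                [set eta' : 'cV[R]_d | pos_vec eta']]].
Proof.
case: d hd A hA => // n _ A A_gt0.
have [y [r [y_gt0 r_gt0 yA]]] := perron_left_eigenvector A_gt0.
have -> : spectral_radius A = r.
  by apply: spectral_radius_eq yA => // [i j|]; exact: ltW.
have r_eig : eigenvalue A r.
  apply/eigenvalueP; exists y => //.
  by apply/eqP => y0; have := y_gt0 0; rewrite y0 mxE ltxx.
have r_le (eta : 'cV[R]_n.+1) : pos_vec eta -> r <= wopnorm1 eta A.
  by move=> /eigenvalue_le_wopnorm1/(_ r_eig); rewrite gtr0_norm.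
have yT_gt0 : pos_vec y^T by move=> i; rewrite mxE.
have opnorm_yT : wopnorm1 y^T A = r.
  apply/eqP; rewrite eq_le r_le // andbT; apply: wopnorm1_le => // j.
  have /rowP/(_ j) := yA; rewrite !mxE => <-.
  by apply: ler_sum => i _; rewrite mxE gtr0_norm // mulrC.
exists y^T; split=> //; first by rewrite trmxK.
apply/eqP; rewrite eq_le; apply/andP; split.
  apply: lb_le_inf; first by exists (wopnorm1 y^T A), y^T.
  by move=> _ [eta eta_gt0 <-]; exact: r_le.
rewrite -[leRHS]opnorm_yT; apply: ge_inf; last by exists y^T.
by exists r => _ [eta eta_gt0 <-]; exact: r_le.
Qed.
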